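(* Consider the first-order semilinear hyperbolic system $$\frac{\partial u}{\partial t}+\sum_{i=1}^3A_i\frac{\partial u}{\partial x^i}=Q(u,u),$$ where $u=(\rho_1,\dots,\rho_l,v_1,\dots,v_m)^T$ is the unknown function of $(t,x^1,x^2,x^3)$, the $\rho_k$ are valued in $\mathbb{R}$, the $v_p$ are valued in $\mathbb{R}^3$, $A_1,A_2,A_3$ are constant real $(l+3m)\times(l+3m)$ matrices, and $Q(u,u)=(Q_1^\rho,\dots,Q_l^\rho,Q_1^v,\dots,Q_m^v)^T$ with $Q_k^\rho$ ($\mathbb{R}$-valued) and $Q_p^v$ ($\mathbb{R}^3$-valued) quadratic in $u$ with constant coefficients. If the system is rotational invariant, then there are real constants $b_{jq}^{11}$, $c_{pk}^{11}$, $d_{pq}^{111}$ ($1\le j,k\le l$, $1\le p,q\le m$) such that, for $i=1,2,3$, $$A_i=\begin{pmatrix}0_{l\times l}&B^i\\ C^i&D^i\end{pmatrix},$$ where $B^i$ is the $l\times 3m$ matrix whose $(j,q)$ block (of size $1\times3$) is $b_{jq}^{11}e_i^T$, $C^i$ is the $3m\times l$ matrix whose $(p,k)$ block (of size $3\times1$) is $c_{pk}^{11}e_i$, and $D^i$ is the $3m\times3m$ matrix whose $(p,q)$ block (of size $3\times3$) is $d_{pq}^{111}E_i$, with $e_1,e_2,e_3$ the standard basis (column vectors) of $\mathbb{R}^3$ and $$E_1=\begin{pmatrix}0&0&0\\0&0&1\\0&-1&0\end{pmatrix},\quad E_2=\begin{pmatrix}0&0&-1\\0&0&0\\1&0&0\end{pmatrix},\quad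 E_3=\begin{pmatrix}0&1&0\\-1&0&0\\0&0&0\end{pmatrix};$$ and there are real constants $\Gamma_{ij}^k$, $\Omega_{sq}^{k11}$, $\bar\Upsilon_{jq}^{p11}$, $\bar\Omega_{sq}^{p111}$ such that $$Q_k^\rho(u,u)=\sum_{i,j=1}^l\Gamma_{ij}^k\rho_i\rho_j+\sum_{s,q=1}^m\Omega_{sq}^{k11}v_s^Tv_q,\qquad k=1,\dots,l,$$ $$Q_p^v(u,u)=\sum_{1\le j\le l,\ 1\le q\le m}\bar\Upsilon_{jq}^{p11}\rho_jv_q+\sum_{s,q=1}^m\bar\Omega_{sq}^{p111}\,v_s\times v_q,\qquad p=1,\dots,m.$$
   Context: Rotational invariance: for $\mathbf O\in\mathbb{R}^{3\times3}$ orthogonal with $\det\mathbf O=1$ and $u=(\rho,v)$, let $u_{\mathbf O}(t,x)$ have components $\rho_k(t,\mathbf Ox)$ and $\mathbf O^Tv_p(t,\mathbf Ox)$. The system is rotational invariant if for every such $\mathbf O$ it is unchanged under $u\mapsto u_{\mathbf O}$, i.e. $u_{\mathbf O}$ satisfies the same system (with the same matrices $A_i$ and the same $Q$) as $u$. The symbol $\times$ denotes the cross product in $\mathbb{R}^3$. *)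

(* Defs.v *)
From mathcomp Require Import all_boot all_order all_algebra.
From mathcomp Require Import all_classical all_reals all_analysis.

Set Implicit Arguments.
Unset Strict Implicit.
Unset Printing Implicit Defensive.

Import Order.TTheory GRing.Theory Num.Theory.
Import numFieldNormedType.Exports.

Local Open Scope classical_set_scope.
Local Open Scope ring_scope.

(* Number of components of u: the sum is 3m, written in the form expected by
   the block operations [\mxcol], [\mxrow] and [\mxblock]. *)
Definition dimu (l m : nat) : nat := (l + \sum_(p < m) 3)%N.

(* All indices are 0-based: 'I_3 = {0, 1, 2} stands for {1, 2, 3}. *)

Section Space.
Variable R : realType.

Definition evec (i : 'I_3) : 'cV[R]_3 := delta_mx i 0.

Definition crossprod (x y : 'cV[R]_3) : 'cV[R]_3 :=
  \col_a nth 0 [:: x 1 0 * y 2 0 - x 2 0 * y 1 0;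
                   x 2 0 * y 0 0 - x 0 0 * y 2 0;
                   x 0 0 * y 1 0 - x 1 0 * y 0 0] a.

Definition Emx (i : 'I_3) : 'M[R]_3 :=
  \matrix_(a, b) nth 0 (nth [::] (nth [::]
    [:: [:: [:: 0;  0; 0]; [::  0; 0; 1]; [:: 0; -1; 0]];
        [:: [:: 0;  0; -1]; [::  0; 0; 0]; [:: 1;  0; 0]];
        [:: [:: 0;  1; 0]; [:: -1; 0; 0]; [:: 0;  0; 0]]] i) a) b.

Definition is_rotation (O : 'M[R]_3) : Prop := O^T *m O = 1%:M /\ \det O = 1.

End Space.

Arguments evec {R}.
Arguments Emx {R}.

Section Unknown.
Variables (R : realType) (l m : nat).

Definition rho (u : 'cV[R]_(dimu l m)) (k : 'I_l) : R := usubmx u k 0.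

Definition vel (u : 'cV[R]_(dimu l m)) (p : 'I_m) : 'cV[R]_3 :=
  submxcol (dsubmx u) p.

Definition mkstate (r : 'I_l -> R) (v : 'I_m -> 'cV[R]_3) :
    'cV[R]_(dimu l m) :=
  col_mx (\col_k r k) (\mxcol_p v p).

End Unknown.

Section System.
Variables (R : realType) (l m : nat).
Let N := dimu l m.

(* The bilinear map whose a-th component has coefficient matrix q a. *)
Definition bilin (q : 'I_N -> 'M[R]_N) (u w : 'cV[R]_N) : 'cV[R]_N :=
  \col_a (u^T *m q a *m w) 0 0.

Definition hyperbolic (A : 'I_3 -> 'M[R]_N) : Prop :=
  forall xi : 'cV[R]_3, diagonalizable (\sum_i xi i 0 *: A i).

Definition dir_t : R * 'cV[R]_3 := (1, 0).
Definition dir_x (i : 'I_3) : R * 'cV[R]_3 := (0, evec i).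

Definition C1_along (U : set (R * 'cV[R]_3)) (d : R * 'cV[R]_3)
    (u : R * 'cV[R]_3 -> 'cV[R]_N) : Prop :=
  (forall z, U z -> derivable u z d) /\
  {within U, continuous (fun z => 'D_d u z)}.

Definition C1_on (U : set (R * 'cV[R]_3)) (u : R * 'cV[R]_3 -> 'cV[R]_N) :
    Prop :=
  [/\ {within U, continuous u}, C1_along U dir_t u
    & forall i, C1_along U (dir_x i) u].

(* Classical solution on the open set U; the values of u outside U are
   irrelevant. *)
Definition solution (A : 'I_3 -> 'M[R]_N) (q : 'I_N -> 'M[R]_N)
    (U : set (R * 'cV[R]_3)) (u : R * 'cV[R]_3 -> 'cV[R]_N) : Prop :=
  C1_on U u /\
  forall z, U z ->
    'D_dir_t u z + \sum_i A i *m 'D_(dir_x i) u z = bilin q (u z) (u z).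

Definition rotate_arg (O : 'M[R]_3) (z : R * 'cV[R]_3) : R * 'cV[R]_3 :=
  (z.1, O *m z.2).

Definition rotate (O : 'M[R]_3) (u : R * 'cV[R]_3 -> 'cV[R]_N) :
    R * 'cV[R]_3 -> 'cV[R]_N :=
  fun z => mkstate (rho (u (rotate_arg O z)))
                   (fun p => O^T *m vel (u (rotate_arg O z)) p).

(* Solutions are taken local, on arbitrary open subsets of space-time, because
   a quadratic source may make every nontrivial solution blow up; if u lives on
   U then u_O lives on {(t, x) | (t, O x) \in U}. *)
Definition rotational_invariant (A : 'I_3 -> 'M[R]_N) (q : 'I_N -> 'M[R]_N) :
    Prop :=
  forall O : 'M[R]_3, is_rotation O ->
  forall (U : set (R * 'cV[R]_3)) (u : R * 'cV[R]_3 -> 'cV[R]_N),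
    open U -> solution A q U u ->
    solution A q (rotate_arg O @^-1` U) (rotate O u).

End System.

Section Blocks.
Variables (R : realType) (l m : nat).

Definition Bmx (b : 'I_l -> 'I_m -> R) (i : 'I_3) :
    'M[R]_(l, \sum_(q < m) 3) :=
  \mxrow_(q < m) \matrix_(j < l) (b j q *: (evec i)^T).

Definition Cmx (c : 'I_m -> 'I_l -> R) (i : 'I_3) :
    'M[R]_(\sum_(p < m) 3, l) :=
  \mxcol_(p < m) \matrix_(a < 3, k < l) (c p k *: evec i) a 0.

Definition Dmx (d : 'I_m -> 'I_m -> R) (i : 'I_3) :
    'M[R]_(\sum_(p < m) 3, \sum_(q < m) 3) :=
  \mxblock_(p < m, q < m) (d p q *: Emx i).

End Blocks.

(* Main.v *)
Require Import Defs.
From mathcomp Require Import all_boot all_order all_algebra.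
From mathcomp Require Import all_classical all_reals all_analysis.
From mathcomp Require Import ring lra.

Set Implicit Arguments.
Unset Strict Implicit.
Unset Printing Implicit Defensive.

Import Order.TTheory GRing.Theory Num.Theory.
Import numFieldNormedType.Exports.

Local Open Scope classical_set_scope.
Local Open Scope ring_scope.

(** The argument produces enough explicit solutions to turn rotational
    invariance into algebra, and then classifies isotropic tensors.

    Solutions. Fix a covector xi, put phi = 1 + xi.x and look for solutions
    u(t, x) = phi^-1 F(t / phi). The substitution reduces the system to the
    ordinary differential equation
      F'(s) = A(xi) (F(s) + s F'(s)) + Q(F(s), F(s)),
    A(xi) being the sum of the xi_i A_i. It has a solution for every initial
    value F(0) = w ([quadratic_ode]), because it can be integrated by power
    series: the coefficients satisfy
      (n+1) a_(n+1) = (n+1) A(xi) a_n + sum_(i <= n) Q(a_i, a_(n-i)),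
    and since the sum has n+1 terms a geometric bound on the a_n propagates.
    At the origin u = w and du/dx_i = - xi_i w, with w and xi arbitrary: these
    solutions ([wave_solution]) probe every matrix A(xi) on every vector.

    Equivariance. The rotated function u_O has the same form, with xi and F
    rotated, and it solves the system too. Writing T for the action of a
    rotation on states, comparing the two equations at the origin gives
      T (A(xi) w + Q(w, w)) = A(xi') T w + Q(T w, T w),  xi' the rotated xi.
    The terms in A are odd in w and those in Q are even, so replacing w by - w
    separates the two: both xi |-> A(xi) and Q commute with rotations
    ([symbol_equivariant], [source_equivariant]).

    Classification. The blocks of A(xi), and of the polarization of Q, are then
    forms and maps of R^3 that are linear in one, two or three vectors and
    invariant or equivariant under rotations. Up to a factor, the only ones are
    zero in rank one, the inner product (or the identity) in rank two and the
    determinant (or the cross product) in rank three ([isotropic1],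
    [isotropic2], [isotropic3]). Two rotations suffice to see
    it: the cyclic permutation of the axes and a quarter turn. *)

(** * Power series with geometrically bounded coefficients *)
Section PowerSeries.
Variable R : realType.
Implicit Types (c d : nat -> R) (M K x : R).

Definition geometric_bound M K c := forall n, `|c n| <= M * K ^+ n.

Lemma geometric_bound_ge0 M K c : geometric_bound M K c -> 0 <= M.
Proof. by move=> /(_ 0%N); rewrite mulr1; apply: le_trans. Qed.

Lemma is_cvg_pseries_geometric M K c x : 0 < K -> geometric_bound M K c ->
  `|x| < K^-1 -> cvgn (pseries c x).
Proof.
move=> K0 cMK xK; apply: normed_cvg.
have M0 := geometric_bound_ge0 cMK.
apply: (@series_le_cvg _ _ (geometric M (K * `|x|))) => [n|n|n|] /=.
- exact: normr_ge0.
- by rewrite mulr_ge0// exprn_ge0// mulr_ge0// ltW.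
- by rewrite normrM normrX exprMn mulrA ler_wpM2r// exprn_ge0.
- apply: is_cvg_geometric_series.
  by rewrite normrM normr_id gtr0_norm// mulrC -ltr_pdivlMr// div1r.
Qed.

(** The factor n+1 brought by differentiation is absorbed by doubling the ratio,
    since n+1 <= 2^n: this keeps derivatives inside the class of sequences with
    a geometric bound, at the price of a smaller disc. *)
Lemma geometric_bound_diffs M K c : 0 < K -> geometric_bound M K c ->
  geometric_bound (M * K) (2 * K) (pseries_diffs c).
Proof.
move=> K0 cMK n; have M0 := geometric_bound_ge0 cMK.
rewrite /pseries_diffs normrM normr_nat exprMn mulrACA [M * _]mulrC -mulrA.
rewrite ler_pM//; last by rewrite -exprS.
by rewrite -natrX ler_nat ltn_expl.
Qed.

(** The radius 1/(8K) leaves room for the two differentiations that termwise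
    differentiation asks for, each of which doubles the ratio. *)
Lemma is_derive_pseries_geometric M K c x : 0 < K -> geometric_bound M K c ->
  `|x| < (8 * K)^-1 ->
  is_derive x 1 (fun y => limn (pseries c y)) (limn (pseries (pseries_diffs c) x)).
Proof.
move=> K0 cMK xK.
have dK := geometric_bound_diffs K0 cMK.
have ddK := geometric_bound_diffs (mulr_gt0 (ltr0Sn _ 1) K0) dK.
have y0 : 0 < (8 * K)^-1 by rewrite invr_gt0 mulr_gt0.
have small a : 0 < a -> a < 8 -> `|(8 * K)^-1| < (a * K)^-1.
  by move=> a0 a8; rewrite gtr0_norm// ltf_pV2 ?posrE ?mulr_gt0// ltr_pM2r.
apply: (@pseries_snd_diffs _ _ (8 * K)^-1).
- by apply: (is_cvg_pseries_geometric K0 cMK); rewrite -[K in ltRHS]mul1r small// ltr1n.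
- by apply: (is_cvg_pseries_geometric _ dK); rewrite ?mulr_gt0// small// ltr_nat.
- apply: (is_cvg_pseries_geometric _ ddK); rewrite ?mulr_gt0//.
  by rewrite mulrA -natrM small// ltr_nat.
- by rewrite [ltRHS]gtr0_norm.
Qed.

Definition cauchy_prod c d n := \sum_(i < n.+1) c i * d (n - i)%N.

(** The product of the two partial sums is a product of polynomials; its
    coefficients of degree less than n are those of the Cauchy product. The
    others, of degree between n and 2n, are bounded by
    M M' (2K|x|)^k <= M M' 4^-k, and there are n <= 2^n of them, so that the
    difference is O(2^-n). *)
Lemma cvg_cauchy_prod M M' K c d x : 0 < K -> geometric_bound M K c ->
  geometric_bound M' K d -> `|x| < (8 * K)^-1 ->
  pseries (cauchy_prod c d) x @ \oo -->
    limn (pseries c x) * limn (pseries d x).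
Proof.
move=> K0 cMK dMK xK; have M0 := geometric_bound_ge0 cMK.
have M'0 := geometric_bound_ge0 dMK.
have xK1 : `|x| < K^-1.
  by rewrite (lt_trans xK)// ltf_pV2 ?posrE ?mulr_gt0// ltr_pMl// ltr1n.
have cc := is_cvg_pseries_geometric K0 cMK xK1.
have cd := is_cvg_pseries_geometric K0 dMK xK1.
suff e0 : (fun n => pseries c x n * pseries d x n - pseries (cauchy_prod c d) x n)
    @ \oo --> (0 : R).
  rewrite -[X in _ --> X]subr0.
  rewrite [pseries (cauchy_prod c d) x](_ : _ = (fun n => pseries c x n *
      pseries d x n - (pseries c x n * pseries d x n -
        pseries (cauchy_prod c d) x n))); last by apply/funext => n; rewrite subKr.
  by apply: cvgB => //; apply: cvgM.
apply/norm_cvg0P; apply: (@squeeze_cvgr _ _ _ _ (cst 0)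
  (geometric (M * M') (2^-1))).
- near=> n => /=; rewrite normr_ge0 andTb.
  pose P := \poly_(i < n) c i; pose Q := \poly_(i < n) d i.
  have hP : pseries c x n = P.[x].
    by rewrite /pseries /series /= big_mkord horner_poly.
  have hQ : pseries d x n = Q.[x].
    by rewrite /pseries /series /= big_mkord horner_poly.
  have sPQ : (size (P * Q)%R <= n + n)%N.
    rewrite (leq_trans (size_polyMleq _ _))// (leq_trans (leq_pred _))//.
    by rewrite leq_add// size_poly.
  have -> : pseries c x n * pseries d x n - pseries (cauchy_prod c d) x n =
      \sum_(k < n) (P * Q)`_(n + k) * x ^+ (n + k).
    rewrite hP hQ -hornerM (horner_coef_wide _ sPQ) big_split_ord /=.
    rewrite addrC; apply/eqP; rewrite subr_eq eq_sym; apply/eqP; congr +%R.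
    rewrite /pseries /series /= big_mkord; apply: eq_bigr => k _.
    rewrite coefM /cauchy_prod; congr *%R; apply: eq_bigr => i _.
    rewrite !coef_poly (leq_ltn_trans (leq_subr _ _))// ifT//.
    by rewrite (leq_trans (ltn_ord i)).
  have coefle k : `|(P * Q)`_k| <= (M * M') * (2 * K) ^+ k.
    rewrite coefM (le_trans (ler_norm_sum _ _ _))//.
    apply: (@le_trans _ _ (\sum_(j < k.+1) (M * M') * K ^+ k)).
      apply: ler_sum => j _; rewrite normrM.
      rewrite -[X in K ^+ X](@subnKC j); last by rewrite -ltnS.
      rewrite exprD mulrACA ler_pM// coef_poly; case: ifP => _ //.
        by rewrite normr0 mulr_ge0// exprn_ge0// ltW.
      by rewrite normr0 mulr_ge0// exprn_ge0// ltW.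
    rewrite sumr_const card_ord -mulrnAr ler_wpM2l ?mulr_ge0//.
    rewrite exprMn -(mulr_natl (K ^+ k)) ler_wpM2r ?exprn_ge0 ?(ltW K0)//.
    by rewrite -natrX ler_nat ltn_expl.
  rewrite (le_trans (ler_norm_sum _ _ _))//.
  apply: (@le_trans _ _ (\sum_(k < n) M * M' * (4^-1) ^+ n)).
    apply: ler_sum => k _; rewrite normrM normrX.
    apply: (@le_trans _ _ (M * M' * (2 * K) ^+ (n + k) * `|x| ^+ (n + k))).
      by rewrite ler_wpM2r// exprn_ge0.
    rewrite -mulrA -exprMn ler_wpM2l ?mulr_ge0//.
    have h4 : 2 * K * `|x| <= 4^-1.
      move: xK; rewrite -[(8 * K)^-1]div1r ltr_pdivlMr ?mulr_gt0// => xK.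
      by rewrite -[4^-1]div1r ler_pdivlMr//; lra.
    apply: (@le_trans _ _ ((4^-1) ^+ (n + k))).
      by rewrite lerXn2r// ?nnegrE ?mulr_ge0// ltW.
    by rewrite ler_wiXn2l ?leq_addr// ?invr_ge0// invf_le1// ler1n.
  rewrite sumr_const card_ord -mulrnAr ler_wpM2l ?mulr_ge0//.
  rewrite -(mulr_natl (4^-1 ^+ n)).
  have -> : (4^-1 : R) = 2^-1 * 2^-1 by rewrite -invfM -natrM.
  rewrite exprMn mulrA ler_piMl ?exprn_ge0 ?invr_ge0//.
  by rewrite exprVn ler_pdivrMr ?exprn_gt0// mul1r -natrX ler_nat ltnW// ltn_expl.
- exact: cvg_cst.
- by apply: cvg_geometric; rewrite ger0_norm ?invr_ge0// invf_lt1// ltr1n.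
Unshelve. all: by end_near. Qed.

End PowerSeries.

(** * The quadratic ordinary differential equation *)

Section QuadraticODE.

Lemma cvg_sumr (R : realType) (T : Type) (G : set_system T) (FG : Filter G)
    (I : finType) (f : I -> T -> R) (l : I -> R) :
  (forall i, f i x @[x --> G] --> l i) ->
  \sum_i f i x @[x --> G] --> \sum_i l i.
Proof.
move=> fl; elim: (index_enum I) => [|i s IH].
  by rewrite big_nil; under eq_fun do rewrite big_nil; exact: cvg_cst.
by rewrite big_cons; under eq_fun do rewrite big_cons; exact: cvgD.
Qed.

Definition C1_curve (R : realType) (n : nat) (r : R) (F F' : R -> 'cV[R]_n) :=
  (forall (x : R) i, `|x| < r -> is_derive x 1 (fun y => F y i 0) (F' x i 0)) /\
  (forall (x : R) i, `|x| < r -> {for x, continuous (fun y => F' y i 0)}).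

Variables (R : realType) (l m : nat).
Let N := dimu l m.
Variables (A : 'M[R]_N) (q : 'I_N -> 'M[R]_N) (F0 : 'cV[R]_N).

Lemma bilinE (u w : 'cV[R]_N) i :
  bilin q u w i 0 = \sum_j \sum_k q i j k * (u j 0 * w k 0).
Proof.
rewrite !mxE exchange_big /=; apply: eq_bigr => k _.
rewrite !mxE mulr_suml; apply: eq_bigr => j _.
by rewrite !mxE; ring.
Qed.

Definition coef_step (n : nat) (g : nat -> 'cV[R]_N) : 'cV[R]_N :=
  A *m g n + n.+1%:R^-1 *: \sum_(i < n.+1) bilin q (g i) (g (n - i)%N).

(** The recursion refers to all the previous coefficients, so its state is a
    whole sequence, correct up to index n. *)
Fixpoint coef_upto (n : nat) : nat -> 'cV[R]_N :=
  if n is n'.+1 then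
    fun k => if (k <= n')%N then coef_upto n' k else coef_step n' (coef_upto n')
  else fun=> F0.

Definition coef n := coef_upto n n.

Lemma coef_uptoE n k : (k <= n)%N -> coef_upto n k = coef k.
Proof.
elim: n => [|n IH]; first by rewrite leqn0 => /eqP->.
rewrite leq_eqVlt => /predU1P[->//|]; rewrite ltnS => kn /=.
by rewrite kn IH.
Qed.

Lemma coefS n : n.+1%:R *: coef n.+1 =
  n.+1%:R *: (A *m coef n) + \sum_(i < n.+1) bilin q (coef i) (coef (n - i)%N).
Proof.
rewrite {1}/coef /= ltnn /coef_step coef_uptoE// scalerDr scalerA.
rewrite divff ?pnatr_eq0// scale1r; congr (_ + _); apply: eq_bigr => i _.
by rewrite !coef_uptoE ?leq_subr// -ltnS.
Qed.

(* M bounds the initial value. K is large enough for the induction step: by the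
   recursion |a_(n+1)| <= (|A| M + |q| M^2) K^n, with |A| and |q| the sums of the
   absolute values of all coefficients. *)
Let M : R := 1 + \sum_i `|F0 i 0|.
Let K : R := \sum_i \sum_j `|A i j| + M * (\sum_i \sum_j \sum_k `|q i j k|) + 1.

Let M0 : 0 <= M.
Proof. by rewrite addr_ge0// sumr_ge0. Qed.

Let le_sum (I : finType) (f : I -> R) i : (forall j, 0 <= f j) -> f i <= \sum_j f j.
Proof. by move=> f0; rewrite (bigD1 i)//= lerDl sumr_ge0. Qed.

Let K_gt0 : 0 < K.
Proof.
rewrite ltr_wpDl// addr_ge0// ?mulr_ge0// ?sumr_ge0// => *; rewrite ?sumr_ge0// => *.
by rewrite sumr_ge0.
Qed.

(** The n+1 products Q(a_i, a_(n-i)) are each of size M^2 K^n, and the factor n+1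
    cancels the one in front of a_(n+1); hence no loss in the ratio. *)
Lemma coef_bound i : geometric_bound M K (fun n => coef n i 0).
Proof.
have K0 := ltW K_gt0.
move=> n; elim/ltn_ind: n i => -[_ i|n IH i].
  by rewrite mulr1 /coef /= /M (le_trans (@le_sum _ (fun i => `|F0 i 0|) i _))// lerDr.
have n0 : 0 < n.+1%:R :> R by [].
rewrite -(ler_pM2l n0) -[n.+1%:R in leLHS]ger0_norm// -normrM.
have -> : n.+1%:R * coef n.+1 i 0 = (n.+1%:R *: coef n.+1) i 0 by rewrite mxE.
rewrite coefS mxE summxE.
have -> : n.+1%:R * (M * K ^+ n.+1) =
    n.+1%:R * (M * K ^+ n * (\sum_i \sum_j `|A i j| + 1)) +
    n.+1%:R * (M ^+ 2 * K ^+ n * (\sum_i \sum_j \sum_k `|q i j k|)).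
  by rewrite exprS {1}/K; ring.
rewrite (le_trans (ler_normD _ _))// lerD//.
  rewrite mxE normrM normr_nat ler_wpM2l// mxE (le_trans (ler_norm_sum _ _ _))//.
  rewrite mulrDr mulr1 ler_wpDr ?mulr_ge0 ?exprn_ge0//.
  apply: (@le_trans _ _ (M * K ^+ n * \sum_j `|A i j|)).
    rewrite mulr_sumr; apply: ler_sum => j _.
    by rewrite normrM mulrC ler_wpM2r// IH.
  rewrite ler_wpM2l ?mulr_ge0 ?exprn_ge0//.
  by apply: (@le_sum _ (fun i => \sum_j `|A i j|) i) => j; rewrite sumr_ge0.
rewrite (le_trans (ler_norm_sum _ _ _))//.
rewrite [leRHS]mulr_natl -[in leRHS](card_ord n.+1) -sumr_const.
apply: ler_sum => k _; rewrite bilinE.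
apply: (@le_trans _ _ (M ^+ 2 * K ^+ n * \sum_j \sum_k `|q i j k|)); last first.
  rewrite ler_wpM2l ?mulr_ge0 ?exprn_ge0//.
  apply: (@le_sum _ (fun i => \sum_j \sum_k `|q i j k|) i) => j.
  by rewrite sumr_ge0// => *; rewrite sumr_ge0.
rewrite (le_trans (ler_norm_sum _ _ _))// mulr_sumr; apply: ler_sum => j _.
rewrite (le_trans (ler_norm_sum _ _ _))// mulr_sumr; apply: ler_sum => h _.
rewrite normrM mulrC ler_wpM2r// normrM.
have kn : (k <= n)%N by rewrite -ltnS.
rewrite -[X in K ^+ X](subnKC kn) exprD expr2 mulrACA.
by rewrite ler_pM// IH// ltnS leq_subr.
Qed.

(** The series with coefficients (n+1) c_n is the derivative of x f(x). *)
Lemma cvg_series_succ (c : nat -> R) x :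
    cvgn (pseries c x) -> cvgn (pseries (pseries_diffs c) x) ->
  (\sum_(0 <= n < k) n.+1%:R * c n * x ^+ n) @[k --> \oo] -->
    limn (pseries c x) + x * limn (pseries (pseries_diffs c) x).
Proof.
move=> cc cd.
rewrite [X in X @ _ --> _](_ : _ = (fun k => pseries c x k +
    x * [series n%:R * c n * x ^+ n.-1]_n k)).
  exact: cvgD cc (cvgMl_tmp (pseries_diffs_equiv cd)).
apply/funext => k.
rewrite /pseries /series /= mulr_sumr -big_split /=.
apply: eq_bigr => -[|n] _ /=; first by rewrite !mul0r mulr0 addr0 mul1r.
by rewrite (exprS x n) -(natr1 n.+1); ring.
Qed.

(** The equation is implicit in F', yet comparing coefficients gives a recursion:
    the coefficient of x^n in F + x F' is (n+1) a_n, which has lower index than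
    the leading (n+1) a_(n+1). *)
Lemma quadratic_ode : exists (r : R) (F F' : R -> 'cV[R]_N),
  [/\ 0 < r, F 0 = F0,
      C1_curve r F F'
    & forall x, `|x| < r -> F' x = A *m (F x + x *: F' x) + bilin q (F x) (F x)].
Proof.
pose c i n := coef n i 0.
have cb i : geometric_bound M K (c i) := @coef_bound i.
have db i := geometric_bound_diffs K_gt0 (cb i).
pose r := (8 * (2 * K))^-1.
have r0 : 0 < r by rewrite invr_gt0 !mulr_gt0.
have r8 : r < (8 * K)^-1.
  by rewrite ltf_pV2 ?posrE ?mulr_gt0// ltr_pM2l// ltr_pMl// ltr1n.
have r2 : r < (2 * K)^-1.
  by rewrite ltf_pV2 ?posrE ?mulr_gt0// ltr_pMl ?mulr_gt0// ltr1n.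
have r1 : r < K^-1.
  by rewrite (lt_trans r2)// ltf_pV2 ?posrE ?mulr_gt0// ltr_pMl// ltr1n.
exists r, (fun x => \col_i limn (pseries (c i) x)),
  (fun x => \col_i limn (pseries (pseries_diffs (c i)) x)); split => //.
- apply/colP => i; rewrite mxE.
  apply: cvg_lim => //; apply: cvg_near_cst; near=> n; rewrite /pseries /series /=.
  rewrite -[n]prednK; last by near: n; exists 1%N.
  rewrite big_nat_recl//= mulr1 big1_seq ?addr0// => j _.
  by rewrite exprS mul0r mulr0.
- split=> x i xr.
    rewrite mxE; under eq_fun do rewrite mxE.
    exact: (is_derive_pseries_geometric K_gt0 (cb i) (lt_trans xr r8)).
  rewrite /prop_for /continuous_at mxE.
  under eq_fun do rewrite mxE.
  apply/differentiable_continuous/derivable1_diffP.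
  have := is_derive_pseries_geometric (mulr_gt0 (ltr0Sn _ 1) K_gt0) (db i) xr.
  by case.
- move=> x xr; apply/colP => i; rewrite [LHS]mxE; apply: cvg_lim => //.
  have cc j := is_cvg_pseries_geometric K_gt0 (cb j) (lt_trans xr r1).
  have cd j := is_cvg_pseries_geometric (mulr_gt0 (ltr0Sn _ 1) K_gt0) (db j)
    (lt_trans xr r2).
  rewrite mxE mxE bilinE.
  rewrite (_ : pseries _ x = (fun n =>
      \sum_j A i j * (\sum_(0 <= k < n) k.+1%:R * c j k * x ^+ k) +
      \sum_j \sum_k q i j k * pseries (cauchy_prod (c j) (c k)) x n)).
    apply: cvgD; apply: cvg_sumr => j.
      by rewrite !mxE; apply: cvgMl_tmp; exact: cvg_series_succ.
    apply: cvg_sumr => k; rewrite !mxE; apply: cvgMl_tmp.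
    exact: (cvg_cauchy_prod K_gt0 (cb j) (cb k) (lt_trans xr r8)).
  apply/funext => n; rewrite /pseries /series /=.
  transitivity (\sum_(0 <= k < n) (\sum_j A i j * (k.+1%:R * c j k * x ^+ k) +
      \sum_j \sum_h q i j h * (cauchy_prod (c j) (c h) k * x ^+ k))).
    apply: eq_bigr => k _; rewrite /pseries_diffs.
    have := congr1 (fun v : 'cV[R]_N => v i 0) (coefS k).
    rewrite /= mxE => ->; rewrite mxE mulrDl; congr (_ + _).
      rewrite !mxE mulr_sumr mulr_suml; apply: eq_bigr => j _.
      by rewrite /c; ring.
    rewrite summxE mulr_suml.
    transitivity (\sum_(a < k.+1) \sum_j \sum_h
        q i j h * (c j a * c h (k - a)%N) * x ^+ k).
      apply: eq_bigr => a _; rewrite bilinE mulr_suml.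
      by apply: eq_bigr => j _; rewrite mulr_suml.
    rewrite exchange_big /=; apply: eq_bigr => j _.
    rewrite exchange_big /=; apply: eq_bigr => h _.
    by rewrite /cauchy_prod mulr_suml mulr_sumr; apply: eq_bigr => a _; ring.
  rewrite big_split /= exchange_big /=; congr (_ + _).
    by apply: eq_bigr => j _; rewrite mulr_sumr.
  rewrite exchange_big /=; apply: eq_bigr => j _.
  by rewrite exchange_big /=; apply: eq_bigr => h _; rewrite mulr_sumr.
Unshelve. all: by end_near. Qed.

End QuadraticODE.

(** * Functions of the form phi^-1 F(t / phi) *)
Section Waves.

Lemma cvg_cV (R : realType) (T : Type) (G : set_system T) (FG : Filter G) n
    (f : T -> 'cV[R]_n) (v : 'cV[R]_n) :
  (forall i, f x i 0 @[x --> G] --> v i 0) -> f x @[x --> G] --> v.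
Proof.
move=> fv; apply/cvgrPdist_le => /= e e0; near=> x.
rewrite /Num.Def.normr/= mx_normrE (bigmax_le _ (ltW e0))//= => -[i j] _.
rewrite !mxE /= ord1; move: i; near: x; apply: filter_forall => /= i.
exact: ((cvgrPdist_le _ _).1 (fv i)).
Unshelve. all: by end_near. Qed.

(** Directional derivatives of a real function only depend on its restriction to
    a line, where the one-variable rules apply. *)
Lemma is_derive_line (R : realType) (V : normedModType R) (f : V -> R) z d a :
  is_derive (0 : R) 1 (fun h : R => f (h *: d + z)) a -> is_derive z d f a.
Proof.
case=> df <-; constructor; first exact/derivable1P.
rewrite /derive; set g1 := fun h => h^-1 *: _; set g2 := fun h => h^-1 *: _.
suff -> : g1 = g2 by [].
by rewrite funeqE /g1 /g2 => h /=; rewrite addr0 scale0r add0r [_%:A]mulr1.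
Qed.

Variables (R : realType) (N : nat).
Implicit Types (xi : 'cV[R]_3) (F : R -> 'cV[R]_N) (z d : R * 'cV[R]_3).

Definition phase xi z : R := 1 + (xi^T *m z.2) 0 0.

Definition wave xi F z : 'cV[R]_N := (phase xi z)^-1 *: F (z.1 / phase xi z).

(** The domain keeps phi positive and the argument t / phi of F in ]-r, r[. *)
Definition wave_dom xi (r : R) : set (R * 'cV[R]_3) :=
  [set z | 0 < phase xi z /\ `|z.1| < r * phase xi z].

(** The derivative of phi^-1 F(t / phi) in the direction d, as the chain rule
    gives it. *)
Definition dwave xi F F' d z : 'cV[R]_N :=
  (phase xi z) ^- 2 *: ((d.1 - z.1 / phase xi z * (xi^T *m d.2) 0 0) *:
      F' (z.1 / phase xi z) - (xi^T *m d.2) 0 0 *: F (z.1 / phase xi z)).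

Lemma phase_line xi z d (h : R) :
  phase xi (h *: d + z) = phase xi z + h * (xi^T *m d.2) 0 0.
Proof.
rewrite /phase /= mulmxDr mxE -scalemxAr mxE; ring.
Qed.

Lemma wave_dom_small xi r z : wave_dom xi r z -> `|z.1 / phase xi z| < r.
Proof.
move=> [p0 pr]; rewrite normrM normfV (gtr0_norm p0).
by rewrite ltr_pdivrMr.
Qed.

Lemma is_derive_wave xi F F' r z d i : C1_curve r F F' -> wave_dom xi r z ->
  is_derive z d (fun z => wave xi F z i 0) (dwave xi F F' d z i 0).
Proof.
move=> [dF _] Uz; have [p0 _] := Uz; apply: is_derive_line.
set p := phase xi z; set b : R := (xi^T *m d.2) 0 0.
have -> : (fun h : R => wave xi F (h *: d + z) i 0) =
    (fun h => (p + h * b)^-1) *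
    ((fun y => F y i 0) \o (fun h => (z.1 + h * d.1) * (p + h * b)^-1)).
  apply/funext => h; rewrite !fctE /wave !mxE phase_line -/p -/b /=.
  by rewrite [_ + z.1]addrC.
have p0' : p + 0 * b != 0 by rewrite mul0r addr0 gt_eqF.
have daff (a c : R) : is_derive (0 : R) 1 (fun h => a + h * c) c.
  have -> : (fun h => a + h * c) = cst a + c \*: (@id R).
    by apply/funext => h; rewrite !fctE /= mulrC.
  by apply: is_derive_eq; rewrite add0r /GRing.scale /= mulr1.
have dinv := @is_deriveV R (fun h => p + h * b) 0 b 1 p0' (daff p b).
have dq := @is_deriveM _ _ (fun h : R => z.1 + h * d.1) (fun h : R => (p + h * b)^-1)
    (0 : R) 1 _ _ (daff z.1 d.1) dinv.
have dF0 := dF (z.1 / phase xi z) i (wave_dom_small Uz).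
have dF1 : is_derive ((z.1 + 0 * d.1) * (p + 0 * b)^-1) 1
   (fun y => F y i 0) (F' (z.1 / phase xi z) i 0) by rewrite !mul0r !addr0.
have dc := @is_derive1_comp _ (fun y => F y i 0) _ (0 : R) _ _ dF1 dq.
have := is_deriveM dinv dc.
move=> H; apply: (is_derive_eq H).
rewrite /= !fctE /dwave -/p -/b !mxE !mul0r !addr0 /GRing.scale /=.
by field; rewrite gt_eqF.
Qed.

Lemma derivable_wave xi F F' r z d : C1_curve r F F' -> wave_dom xi r z ->
  derivable (wave xi F) z d /\ 'D_d (wave xi F) z = dwave xi F F' d z.
Proof.
move=> FF' Uz.
have dw i := is_derive_wave d i FF' Uz.
have dv : derivable (wave xi F) z d.
  by apply/derivable_mxP => i j; rewrite ord1; case: (dw i).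
split=> //; rewrite derive_mx//; apply/colP => i; rewrite mxE.
by case: (dw i).
Qed.

Lemma cvg_phase xi z : phase xi x @[x --> z] --> phase xi z.
Proof.
apply: cvgD; first exact: cvg_cst.
rewrite mxE; under eq_fun do rewrite mxE.
apply: cvg_sumr => i; apply: cvgMl_tmp.
apply: (@continuous_comp _ _ _ snd (fun v : 'cV[R]_3 => v i 0) z).
  exact: cvg_snd.
exact: coord_continuous.
Qed.

Lemma open_wave_dom xi r : open (wave_dom xi r).
Proof.
have -> : wave_dom xi r = phase xi @^-1` [set y | 0 < y] `&`
    (fun z => r * phase xi z - `|z.1|) @^-1` [set y | 0 < y].
  by apply/seteqP; split => z /= [p0 pr]; split=> //; move: pr; rewrite subr_gt0.
apply: openI; (apply: open_comp; last exact: open_gt) => z _.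
- exact: cvg_phase.
- apply: cvgB; first by apply: cvgMl_tmp; exact: cvg_phase.
  by apply: cvg_norm; exact: cvg_fst.
Qed.

Lemma cvg_theta xi r z : wave_dom xi r z ->
  x.1 / phase xi x @[x --> z] --> z.1 / phase xi z.
Proof.
move=> [p0 _]; apply: cvgM; first exact: cvg_fst.
by apply: cvgV; [rewrite gt_eqF|exact: cvg_phase].
Qed.

Lemma cvg_curve xi r z (g : R -> R) : wave_dom xi r z ->
  {for (z.1 / phase xi z), continuous g} ->
  g (x.1 / phase xi x) @[x --> z] --> g (z.1 / phase xi z).
Proof. by move=> Uz cg; exact: (continuous_cvg _ cg (cvg_theta Uz)). Qed.

Lemma continuous_C1_curve F F' r x i : C1_curve r F F' -> `|x| < r ->
  {for x, continuous (fun y => F y i 0)}.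
Proof.
move=> [dF _] xr; apply/differentiable_continuous/derivable1_diffP.
by case: (dF _ i xr).
Qed.

Lemma cvg_wave xi F F' r z : C1_curve r F F' -> wave_dom xi r z ->
  wave xi F x @[x --> z] --> wave xi F z.
Proof.
move=> FF' Uz; have [p0 _] := Uz; apply: cvg_cV => i.
rewrite mxE; under eq_fun do rewrite mxE; apply: cvgM.
  by apply: cvgV; [rewrite gt_eqF|exact: cvg_phase].
apply: (@cvg_curve _ _ _ (fun y => F y i 0) Uz).
exact: (continuous_C1_curve FF' (wave_dom_small Uz)).
Qed.

Lemma cvg_dwave xi F F' r z d : C1_curve r F F' -> wave_dom xi r z ->
  dwave xi F F' d x @[x --> z] --> dwave xi F F' d z.
Proof.
move=> FF' Uz; have [p0 _] := Uz; have sm := wave_dom_small Uz.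
apply: cvg_cV => i.
rewrite !mxE; under eq_fun do rewrite !mxE.
have p20 : phase xi z ^+ 2 != 0 by rewrite expf_neq0// gt_eqF.
apply: cvgM.
  apply: cvgV => //; rewrite expr2; under eq_fun do rewrite expr2.
  by apply: cvgM; exact: cvg_phase.
apply: cvgB.
  apply: cvgM; last exact: (@cvg_curve _ _ _ (fun y => F' y i 0) Uz (FF'.2 _ i sm)).
  apply: cvgB; first exact: cvg_cst.
  by apply: cvgMr_tmp; exact: cvg_theta Uz.
apply: cvgMl_tmp.
exact: (@cvg_curve _ _ _ (fun y => F y i 0) Uz (continuous_C1_curve FF' sm)).
Qed.

End Waves.

(** * Equivariance of the matrices and of the source *)
Section Equivariance.
Variables (R : realType) (l m : nat).
Let N := dimu l m.
Variables (A : 'I_3 -> 'M[R]_N) (q : 'I_N -> 'M[R]_N).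
Implicit Types (xi : 'cV[R]_3) (F : R -> 'cV[R]_N) (u w : 'cV[R]_N).

Definition symbol xi : 'M[R]_N := \sum_i xi i 0 *: A i.

Definition rotmx (O : 'M[R]_3) : 'M[R]_N :=
  block_mx 1%:M 0 0 (\mxdiag_(p < m) O).

Lemma rotmxE O u : rotmx O *m u = mkstate (rho u) (fun p => O *m vel u p).
Proof.
rewrite -[u in LHS]vsubmxK mul_block_col mul1mx !mul0mx addr0 add0r /mkstate.
congr col_mx; first by apply/colP => k; rewrite [RHS]mxE.
by rewrite -[dsubmx u in LHS]submxcolK mul_mxdiag_mxcol.
Qed.

Lemma bilinZ (a b : R) u w : bilin q (a *: u) (b *: w) = (a * b) *: bilin q u w.
Proof.
apply/colP => i; rewrite [RHS]mxE !bilinE mulr_sumr; apply: eq_bigr => j _.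
by rewrite mulr_sumr; apply: eq_bigr => k _; rewrite !mxE; ring.
Qed.

Lemma bilinNN u w : bilin q (- u) (- w) = bilin q u w.
Proof. by rewrite -(scaleN1r u) -(scaleN1r w) bilinZ mulN1r opprK scale1r. Qed.

Lemma tr_mul_evec xi i : (xi^T *m evec i) 0 0 = xi i 0.
Proof. by rewrite -colE !mxE. Qed.

(** With phi the phase, the time derivative of phi^-1 F(t / phi) is phi^-2 F' and
    the derivative along x_i is - xi_i phi^-2 (F + s F') at s = t / phi, while the
    source is phi^-2 Q(F, F): the factor phi^-2 cancels and the system at (t, x) is
    the differential equation at s. *)
Lemma wave_solution xi (r : R) F F' : C1_curve r F F' ->
  (forall x : R, `|x| < r ->
    F' x = symbol xi *m (F x + x *: F' x) + bilin q (F x) (F x)) ->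
  solution A q (wave_dom xi r) (wave xi F).
Proof.
move=> FF' ode.
have C1 d : C1_along (wave_dom xi r) d (wave xi F).
  split=> [z Uz|]; first by have [] := derivable_wave d FF' Uz.
  apply: continuous_in_subspaceT => z; rewrite inE => Uz.
  have [_ Dz] := derivable_wave d FF' Uz.
  rewrite /continuous_at Dz; have := cvg_dwave (d := d) FF' Uz.
  apply: cvg_trans; apply: near_eq_cvg.
  have : \forall x \near z, wave_dom xi r x.
    by apply: open_nbhs_nbhs; split=> //; exact: open_wave_dom.
  by apply: filterS => x Ux; rewrite (derivable_wave d FF' Ux).2.
split; first split=> //.
  apply: continuous_in_subspaceT => z; rewrite inE => Uz; exact: cvg_wave FF' Uz.
move=> z Uz; rewrite (derivable_wave _ FF' Uz).2.
under eq_bigr do rewrite (derivable_wave _ FF' Uz).2.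
rewrite /dwave /= mulmx0 mxE mulr0 subr0 scale1r scale0r subr0.
rewrite /wave bilinZ.
set t := z.1 / phase xi z.
have -> : \sum_i A i *m (phase xi z ^- 2 *: ((0 - t * (xi^T *m evec i) 0 0) *: F' t -
     (xi^T *m evec i) 0 0 *: F t)) =
   - phase xi z ^- 2 *: (symbol xi *m (F t + t *: F' t)).
  rewrite /symbol mulmx_suml scaler_sumr; apply: eq_bigr => i _.
  rewrite tr_mul_evec -scalemxAl -!scalemxAr mulmxBr mulmxDr -!scalemxAr.
  rewrite sub0r scaleNr -opprD scalerN scaleNr; congr (- (_ *: _)).
  by rewrite scalerDr scalerA [xi i 0 * t]mulrC addrC.
rewrite [X in _ *: X + _](ode t (wave_dom_small Uz)).
by rewrite scalerDr scaleNr addrAC subrr add0r -expr2 exprVn.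
Qed.

Lemma C1_curve_mulmx r F F' (T : 'M[R]_N) : C1_curve r F F' ->
  C1_curve r (fun x => T *m F x) (fun x => T *m F' x).
Proof.
move=> [dF cF]; split=> x i xr.
  have -> : (fun y => (T *m F y) i 0) =
      \sum_(j < N) (T i j \*: (fun y => F y j 0)).
    by apply/funext => y; rewrite fct_sumE mxE.
  rewrite mxE; apply: is_derive_sum => j; have := dF _ j xr => ?.
  exact: is_deriveZ.
rewrite /prop_for /continuous_at mxE; under eq_fun do rewrite mxE.
by apply: cvg_sumr => j; apply: cvgMl_tmp; exact: cF.
Qed.

Lemma rotate_wave O xi F :
  rotate O (wave xi F) = wave (O^T *m xi) (fun x => rotmx O^T *m F x).
Proof.
apply/funext => z; rewrite /rotate -rotmxE /wave.
have -> : phase xi (rotate_arg O z) = phase (O^T *m xi) z.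
  by rewrite /phase /= trmx_mul trmxK mulmxA.
by rewrite -scalemxAr.
Qed.

(** Both equivariances come from the same solutions: the terms in A are odd in u
    and those in Q are even. *)
Lemma equivariant_tr O xi u : is_rotation O -> rotational_invariant A q ->
  symbol (O^T *m xi) *m (rotmx O^T *m u) = rotmx O^T *m (symbol xi *m u) /\
  bilin q (rotmx O^T *m u) (rotmx O^T *m u) = rotmx O^T *m bilin q u u.
Proof.
move=> rO inv; set T := rotmx O^T; set S := symbol (O^T *m xi).
have main w : T *m (symbol xi *m w + bilin q w w) =
    S *m (T *m w) + bilin q (T *m w) (T *m w).
  have [r [F [F' [r0 F0 FF' ode]]]] := quadratic_ode (symbol xi) q w.
  have := inv O rO _ _ (@open_wave_dom _ xi r) (wave_solution FF' ode).
  rewrite rotate_wave => -[_ eq0].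
  have TFF' := C1_curve_mulmx T FF'.
  have p0 (v : 'cV[R]_3) : phase v 0 = 1 by rewrite /phase /= mulmx0 mxE addr0.
  have U0 (v : 'cV[R]_3) : wave_dom v r 0.
    by rewrite /wave_dom /= p0 normr0 mulr1.
  have := eq0 0; rewrite /= /rotate_arg /= mulmx0 => /(_ (U0 xi)).
  rewrite (derivable_wave _ TFF' (U0 _)).2.
  under eq_bigr do rewrite (derivable_wave _ TFF' (U0 _)).2.
  rewrite /dwave /wave p0 /= !expr1n !invr1 !mul0r !scale1r mulmx0 mxE.
  rewrite subr0 scale1r scale0r subr0 F0 -/T => e.
  (* At s = 0 the differential equation gives F' explicitly. *)
  have F'0 : F' 0 = symbol xi *m w + bilin q w w.
    by rewrite ode ?normr0// scale0r addr0 F0.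
  rewrite -F'0; apply/eqP; rewrite addrC -subr_eq; apply/eqP; rewrite -e; congr (_ + _).
  rewrite /S /symbol mulmx_suml -sumrN; apply: eq_bigr => i _.
  rewrite mul0r subr0 scale0r sub0r scale1r tr_mul_evec mulmxN -scalemxAr.
  by rewrite -scalemxAl.
have e1 := main u; have := main (- u).
rewrite !mulmxN !bilinNN mulmxDr mulmxN => e2; move: e1; rewrite mulmxDr => e1.
have h : T *m (symbol xi *m u) = S *m (T *m u).
  have : T *m (symbol xi *m u) *+ 2 = S *m (T *m u) *+ 2.
    have := congr2 (fun x y => x - y) e1 e2.
    by rewrite !opprD !opprK addrACA subrr addr0 addrACA subrr addr0 -!mulr2n.
  move: (T *m _) (S *m _) => a b.
  rewrite -(scaler_nat 2 a) -(scaler_nat 2 b) => /(congr1 ( *:%R 2^-1)).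
  by rewrite !scalerA mulVf ?pnatr_eq0// !scale1r.
split; first by [].
by move: e1; rewrite h => /addrI.
Qed.

Lemma is_rotation_tr (O : 'M[R]_3) : is_rotation O -> is_rotation O^T.
Proof.
by move=> [OO dO]; split; [rewrite trmxK; exact: mulmx1C|rewrite det_tr].
Qed.

Lemma symbol_equivariant O xi u : rotational_invariant A q -> is_rotation O ->
  symbol (O *m xi) *m (rotmx O *m u) = rotmx O *m (symbol xi *m u).
Proof.
move=> inv rO; have := equivariant_tr xi u (is_rotation_tr rO) inv.
by rewrite trmxK => -[].
Qed.

Lemma source_equivariant O u : rotational_invariant A q -> is_rotation O ->
  bilin q (rotmx O *m u) (rotmx O *m u) = rotmx O *m bilin q u u.
Proof.
move=> inv rO; have := equivariant_tr 0 u (is_rotation_tr rO) inv.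
by rewrite trmxK => -[].
Qed.

End Equivariance.

(** * Isotropic tensors of rank at most three *)
Section Isotropic.
Variable R : realType.
Implicit Types (x y z : 'cV[R]_3) (O : 'M[R]_3).

Lemma sum3E (V : zmodType) (f : 'I_3 -> V) : \sum_a f a = f 0 + f 1 + f 2.
Proof.
rewrite !big_ord_recl big_ord0 addr0 addrA.
by congr (_ + f _ + f _); apply: val_inj.
Qed.

Lemma ord3P (P : 'I_3 -> Prop) : P 0 -> P 1 -> P 2 -> forall a, P a.
Proof.
move=> P0 P1 P2 [[|[|[|//]]] a3].
- by rewrite (_ : Ordinal a3 = 0)//; apply: val_inj.
- by rewrite (_ : Ordinal a3 = 1)//; apply: val_inj.
- by rewrite (_ : Ordinal a3 = 2)//; apply: val_inj.
Qed.

Lemma ord3_1D1 : 1 + 1 = 2 :> 'I_3. Proof. exact: val_inj. Qed.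

Lemma ord3_2D1 : 2 + 1 = 0 :> 'I_3. Proof. exact: val_inj. Qed.

Definition cyc : 'M[R]_3 := \matrix_(a, b)
  nth 0 (nth [::] [:: [:: 0; 0; 1]; [:: 1; 0; 0]; [:: 0; 1; 0]] a) b.

Definition quarter : 'M[R]_3 := \matrix_(a, b)
  nth 0 (nth [::] [:: [:: 0; -1; 0]; [:: 1; 0; 0]; [:: 0; 0; 1]] a) b.

Lemma det3E (M : 'M[R]_3) : \det M =
  M 0 0 * (M 1 1 * M 2 2 - M 1 2 * M 2 1)
  - M 0 1 * (M 1 0 * M 2 2 - M 1 2 * M 2 0)
  + M 0 2 * (M 1 0 * M 2 1 - M 1 1 * M 2 0).
Proof.
have o2 (f : 'I_2 -> R) : \sum_a f a = f 0 + f 1.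
  by rewrite !big_ord_recl big_ord0 addr0; congr (_ + f _); apply: val_inj.
rewrite (expand_det_row _ 0) sum3E /cofactor.
rewrite !(expand_det_row _ (0 : 'I_2)) !o2 /cofactor !det_mx11 !mxE.
rewrite (_ : lift 0 0 = 1 :> 'I_2); last exact: val_inj.
rewrite (_ : lift 1 0 = 0 :> 'I_2); last exact: val_inj.
rewrite (_ : lift 0 0 = 1 :> 'I_3); last exact: val_inj.
rewrite (_ : lift 0 1 = 2 :> 'I_3); last exact: val_inj.
rewrite (_ : lift 1 0 = 0 :> 'I_3); last exact: val_inj.
rewrite (_ : lift 1 1 = 2 :> 'I_3); last exact: val_inj.
rewrite (_ : lift 2 0 = 0 :> 'I_3); last exact: val_inj.
rewrite (_ : lift 2 1 = 1 :> 'I_3); last exact: val_inj.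
rewrite /= !(expr0, expr1, expr2); ring.
Qed.

Lemma cyc_rotation : is_rotation cyc.
Proof.
split; last by rewrite det3E !mxE /=; ring.
apply/matrixP; apply: ord3P; apply: ord3P; rewrite !mxE sum3E !mxE /=; ring.
Qed.

Lemma quarter_rotation : is_rotation quarter.
Proof.
split; last by rewrite det3E !mxE /=; ring.
apply/matrixP; apply: ord3P; apply: ord3P; rewrite !mxE sum3E !mxE /=; ring.
Qed.

Lemma cyc_evec a : cyc *m evec a = evec (a + 1).
Proof.
rewrite /evec -colE; apply/colP; move: a.
by apply: ord3P; apply: ord3P; rewrite !mxE.
Qed.

Lemma quarter_evec : [/\ quarter *m evec 0 = evec 1,
  quarter *m evec 1 = - evec 0 & quarter *m evec 2 = evec 2].
Proof.
by split; rewrite /evec -colE; apply/colP; apply: ord3P; rewrite !mxE /= ?oppr0.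
Qed.

(** Two quarter turns change the sign of the first two axes, so an isotropic
    tensor vanishes at the indices that contain an odd number of them. *)
Lemma half_turn_evec a :
  quarter *m (quarter *m evec a) = (-1) ^+ (a != 2) *: evec a.
Proof.
have [q0 q1 q2] := quarter_evec.
move: a; apply: ord3P; rewrite /= ?expr1 ?expr0 ?scaleN1r ?scale1r.
- by rewrite q0 q1.
- by rewrite q1 mulmxN q0.
- by rewrite !q2.
Qed.

Section ScalarForm.
Variables (f : 'cV[R]_3 -> R) (fl : scalar f).

Lemma scalar0 : f 0 = 0.
Proof. by have := fl (-1) 0 0; rewrite scaler0 addr0 mulN1r addNr. Qed.

Lemma scalarZ a x : f (a *: x) = a * f x.
Proof. by have := fl a x 0; rewrite scalar0 !addr0. Qed.

Lemma scalar_expand x :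
  f x = x 0 0 * f (evec 0) + x 1 0 * f (evec 1) + x 2 0 * f (evec 2).
Proof.
rewrite -addrA -[x 2 0 * _]addr0 -scalar0 -!fl; congr f.
by apply/colP; apply: ord3P; rewrite !mxE /= ?(mulr0, mulr1, addr0, add0r).
Qed.

End ScalarForm.

Lemma eq_odd_sign_eq0 (n : nat) (a : R) : odd n -> a = (-1) ^+ n * a -> a = 0.
Proof.
move=> on; rewrite -signr_odd on expr1 mulN1r => /eqP.
by rewrite -subr_eq0 opprK -mulr2n mulrn_eq0 => /eqP.
Qed.

(** The half-turn kills the value at the first axis, hence at all of them. *)
Lemma isotropic1 (f : 'cV[R]_3 -> R) : scalar f ->
  (forall O x, is_rotation O -> f (O *m x) = f x) -> forall x, f x = 0.
Proof.
move=> fl inv x.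
have fc a : f (evec (a + 1)) = f (evec a).
  by rewrite -cyc_evec inv//; exact: cyc_rotation.
have f0 : f (evec 0) = 0.
  apply: (@eq_odd_sign_eq0 1) => //.
  have rq := quarter_rotation.
  by rewrite -[LHS](inv quarter _ rq) -[LHS](inv quarter _ rq) half_turn_evec scalarZ.
have f1 : f (evec 1) = 0 by rewrite -[1]add0r fc.
have f2 : f (evec 2) = 0 by rewrite -ord3_1D1 fc.
by rewrite (scalar_expand fl) f0 f1 f2 !mulr0 !addr0.
Qed.

(** The half-turn kills the off-diagonal entries, and cyclic permutations make
    the diagonal ones equal. *)
Lemma isotropic2 (g : 'cV[R]_3 -> 'cV[R]_3 -> R) :
  (forall y, scalar (g^~ y)) -> (forall x, scalar (g x)) ->
  (forall O x y, is_rotation O -> g (O *m x) (O *m y) = g x y) ->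
  forall x y, g x y = g (evec 0) (evec 0) * (x^T *m y) 0 0.
Proof.
move=> gl gr inv x y; pose t a b := g (evec a) (evec b).
have tc a b : t (a + 1) (b + 1) = t a b.
  by rewrite /t -!cyc_evec inv//; exact: cyc_rotation.
have th a b : odd ((a != 2) + (b != 2)) -> t a b = 0.
  move=> ab; apply: (eq_odd_sign_eq0 ab).
  rewrite exprD mulrAC mulrC -(scalarZ (gl _)) -(scalarZ (gr _)).
  by rewrite -!half_turn_evec !inv//; exact: quarter_rotation.
have t0 a b : a != b -> t a b = 0.
  (* Two distinct axes can be turned so that exactly one of them is the axis
     of the half-turn. *)
  have : a != b -> [|| odd ((a != 2) + (b != 2)),
      odd ((a + 1 != 2) + (b + 1 != 2)) |
      odd ((a + 1 + 1 != 2) + (b + 1 + 1 != 2))].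
    by move: a b; apply: ord3P; apply: ord3P.
  move=> h /h /or3P[] /th //; first by rewrite tc.
  by rewrite !tc.
have t1 : t 1 1 = t 0 0 by rewrite -(tc 0 0) add0r.
have t2 : t 2 2 = t 0 0 by rewrite -ord3_1D1 tc.
rewrite (scalar_expand (gl y)) !(scalar_expand (gr (evec _)) y) -!/(t _ _).
rewrite t1 t2 (t0 0 1)// (t0 0 2)// (t0 1 0)// (t0 1 2)// (t0 2 0)// (t0 2 1)//.
by rewrite /t !mxE sum3E !mxE; ring.
Qed.

(** Only the entries indexed by permutations of the axes survive the half-turn.
    Cyclic permutations leave two of them independent, and the quarter turn makes
    these opposite: the tensor is a multiple of the determinant. *)
Lemma isotropic3 (h : 'cV[R]_3 -> 'cV[R]_3 -> 'cV[R]_3 -> R) :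
  (forall y z, scalar (fun x => h x y z)) ->
  (forall x z, scalar (fun y => h x y z)) ->
  (forall x y, scalar (h x y)) ->
  (forall O x y z, is_rotation O -> h (O *m x) (O *m y) (O *m z) = h x y z) ->
  forall x y z, h x y z =
    h (evec 0) (evec 1) (evec 2) * (z^T *m crossprod x y) 0 0.
Proof.
move=> h1 h2 h3 inv x y z; pose t a b c := h (evec a) (evec b) (evec c).
have tc a b c : t (a + 1) (b + 1) (c + 1) = t a b c.
  by rewrite /t -!cyc_evec inv//; exact: cyc_rotation.
have th a b c : odd ((a != 2) + (b != 2) + (c != 2)) -> t a b c = 0.
  move=> abc; apply: (eq_odd_sign_eq0 abc).
  rewrite !exprD -!mulrA -(scalarZ (h3 _ _)) -(scalarZ (h2 _ _)).
  rewrite -(scalarZ (h1 _ _)) -!half_turn_evec.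
  by rewrite !inv//; exact: quarter_rotation.
have t0 a b c : ~~ uniq [:: a; b; c] -> t a b c = 0.
  (* Up to a cyclic relabelling of the axes, a triple with a repetition has an
     odd number of entries off the axis of the half-turn. *)
  have : ~~ uniq [:: a; b; c] -> [|| odd ((a != 2) + (b != 2) + (c != 2)),
      odd ((a + 1 != 2) + (b + 1 != 2) + (c + 1 != 2)) |
      odd ((a + 1 + 1 != 2) + (b + 1 + 1 != 2) + (c + 1 + 1 != 2))].
    by move: a b c; apply: ord3P; apply: ord3P; apply: ord3P.
  move=> k /k /or3P[] /th //; first by rewrite tc.
  by rewrite !tc.
have t0l a b : t a a b = 0 by rewrite t0//= inE eqxx.
have t0m a b : t a b a = 0 by rewrite t0//= !inE eqxx orbT.
have t0r a b : t a b b = 0 by rewrite t0//= !inE eqxx andbF.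
have t120 : t 1 2 0 = t 0 1 2 by rewrite -(tc 0 1 2) ord3_1D1 ord3_2D1 add0r.
have t201 : t 2 0 1 = t 0 1 2 by rewrite -t120 -(tc 1 2 0) ord3_1D1 ord3_2D1 add0r.
have t102 : t 1 0 2 = - t 0 1 2.
  have [q0 q1 q2] := quarter_evec.
  have := inv quarter (evec 0) (evec 1) (evec 2) quarter_rotation.
  by rewrite q0 q1 q2 -scaleN1r (scalarZ (h2 _ _)) mulN1r /t => <-; rewrite opprK.
have t210 : t 2 1 0 = - t 0 1 2 by rewrite -t102 -(tc 1 0 2) ord3_1D1 ord3_2D1 add0r.
have t021 : t 0 2 1 = - t 0 1 2 by rewrite -t210 -(tc 2 1 0) ord3_1D1 ord3_2D1 add0r.
rewrite (scalar_expand (h1 y z)) !(scalar_expand (h2 (evec _) z) y).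
rewrite !(scalar_expand (h3 (evec _) (evec _)) z) -!/(t _ _ _).
rewrite !(t0l, t0m, t0r) t120 t201 t102 t210 t021.
by rewrite !mxE sum3E !mxE /=; ring.
Qed.

Lemma evec_pair (a : 'I_3) x : ((evec a)^T *m x) 0 0 = x a 0.
Proof. by rewrite trmx_delta -rowE mxE. Qed.

(** Rotations preserve the inner product, so that pairing the value of an
    equivariant map with a further vector gives an invariant form. *)
Lemma rot_pair O x y : is_rotation O -> (O *m x)^T *m (O *m y) = x^T *m y.
Proof. by case=> OO _; rewrite trmx_mul mulmxA -(mulmxA x^T) OO mulmx1. Qed.

Lemma scalar_pair x : scalar (fun y => (y^T *m x) 0 0).
Proof. by move=> a u v; rewrite linearP mulmxDl -scalemxAl !mxE. Qed.

Lemma isotropic_vector x : (forall O, is_rotation O -> O *m x = x) -> x = 0.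
Proof.
move=> inv; apply/colP => a; rewrite [RHS]mxE -evec_pair.
apply: (@isotropic1 (fun y => (y^T *m x) 0 0)); first exact: scalar_pair.
by move=> O y rO; rewrite -[in LHS](inv O rO) rot_pair.
Qed.

Lemma isotropic_linear (f : 'cV[R]_3 -> 'cV[R]_3) : linear f ->
  (forall O x, is_rotation O -> f (O *m x) = O *m f x) ->
  forall x, f x = f (evec 0) 0 0 *: x.
Proof.
move=> fl inv x; apply/colP => a; rewrite [RHS]mxE -[LHS]evec_pair.
rewrite (@isotropic2 (fun x y => (y^T *m f x) 0 0)).
- by rewrite evec_pair; congr (_ * _); rewrite /evec -colE !mxE.
- by move=> y b u v; rewrite fl mulmxDr -scalemxAr !mxE.
- by move=> u; exact: scalar_pair.
- by move=> O u v rO; rewrite inv// rot_pair.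
Qed.

Lemma isotropic_bilinear (f : 'cV[R]_3 -> 'cV[R]_3 -> 'cV[R]_3) :
  (forall y, linear (f^~ y)) -> (forall x, linear (f x)) ->
  (forall O x y, is_rotation O -> f (O *m x) (O *m y) = O *m f x y) ->
  forall x y, f x y = f (evec 0) (evec 1) 2 0 *: crossprod x y.
Proof.
move=> fl fr inv x y; apply/colP => a; rewrite [RHS]mxE -[LHS]evec_pair.
rewrite (@isotropic3 (fun x y z => (z^T *m f x y) 0 0)) ?evec_pair//.
- by move=> v w b u u'; rewrite fl mulmxDr -scalemxAr !mxE.
- by move=> v w b u u'; rewrite fr mulmxDr -scalemxAr !mxE.
- by move=> u v; exact: scalar_pair.
- by move=> O u v w rO; rewrite inv// rot_pair.
Qed.

End Isotropic.

(** * Decomposition of states *)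
Section States.
Variables (R : realType) (l m : nat).
Let N := dimu l m.
Implicit Types (u w : 'cV[R]_N) (O : 'M[R]_3) (x : 'cV[R]_3).

Lemma rho_mkstate r v k : rho (@mkstate R l m r v) k = r k.
Proof. by rewrite /rho /mkstate col_mxKu mxE. Qed.

Lemma vel_mkstate r v p : vel (@mkstate R l m r v) p = v p.
Proof. by rewrite /vel /mkstate col_mxKd mxcolK. Qed.

Lemma rho_linear (a : R) u w k : rho (a *: u + w) k = a * rho u k + rho w k.
Proof. by rewrite /rho linearP !mxE. Qed.

Lemma vel_linear (a : R) u w p : vel (a *: u + w) p = a *: vel u p + vel w p.
Proof.
rewrite /vel linearP submxcolD; congr (_ + _).
by apply/matrixP => i j; rewrite !mxE.
Qed.

Lemma state_eq u w : (forall k, rho u k = rho w k) ->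
  (forall p, vel u p = vel w p) -> u = w.
Proof.
move=> r v; rewrite -[u]vsubmxK -[w]vsubmxK; congr col_mx.
  by apply/colP => k; exact: r.
by apply/mxcolP => p; exact: v.
Qed.

Lemma rho0 k : rho (0 : 'cV[R]_N) k = 0.
Proof. by have := rho_linear (-1) 0 0 k; rewrite scaler0 addr0 mulN1r addNr. Qed.

Lemma vel0 p : vel (0 : 'cV[R]_N) p = 0.
Proof. by have := vel_linear (-1) 0 0 p; rewrite scaler0 addr0 scaleN1r addNr. Qed.

Lemma rhoZ (a : R) u k : rho (a *: u) k = a * rho u k.
Proof. by rewrite -[a *: u]addr0 rho_linear rho0 addr0. Qed.

Lemma velZ (a : R) u p : vel (a *: u) p = a *: vel u p.
Proof. by rewrite -[a *: u]addr0 vel_linear vel0 addr0. Qed.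

Lemma rhoD u w k : rho (u + w) k = rho u k + rho w k.
Proof. by rewrite -[u]scale1r rho_linear mul1r scale1r. Qed.

Lemma velD u w p : vel (u + w) p = vel u p + vel w p.
Proof. by rewrite -[u]scale1r vel_linear !scale1r. Qed.

Lemma rho_sum (I : finType) (f : I -> 'cV[R]_N) k :
  rho (\sum_i f i) k = \sum_i rho (f i) k.
Proof. exact: (big_morph (fun u => rho u k) (fun u w => rhoD u w k) (rho0 k)). Qed.

Lemma vel_sum (I : finType) (f : I -> 'cV[R]_N) p :
  vel (\sum_i f i) p = \sum_i vel (f i) p.
Proof. exact: (big_morph (fun u => vel u p) (fun u w => velD u w p) (vel0 p)). Qed.

Lemma rho_rotmx O u k : rho (rotmx l m O *m u) k = rho u k.
Proof. by rewrite rotmxE rho_mkstate. Qed.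

Lemma vel_rotmx O u p : vel (rotmx l m O *m u) p = O *m vel u p.
Proof. by rewrite rotmxE vel_mkstate. Qed.

Definition scalar_state (j : 'I_l) : 'cV[R]_N := mkstate (fun k => (k == j)%:R) (fun=> 0).

Definition vector_state (s : 'I_m) x : 'cV[R]_N :=
  mkstate (fun=> 0) (fun p => (p == s)%:R *: x).

Lemma rotmx_scalar O j : rotmx l m O *m scalar_state j = scalar_state j.
Proof.
apply: state_eq => [k|p]; first by rewrite rho_rotmx.
by rewrite vel_rotmx vel_mkstate mulmx0.
Qed.

Lemma rotmx_vector O s x : rotmx l m O *m vector_state s x = vector_state s (O *m x).
Proof.
apply: state_eq => [k|p]; first by rewrite rho_rotmx !rho_mkstate.
by rewrite vel_rotmx !vel_mkstate scalemxAr.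
Qed.

Lemma vector_state_linear s : linear (vector_state s).
Proof.
move=> a x y; apply: state_eq => [k|p].
  by rewrite rho_linear !rho_mkstate mulr0 addr0.
by rewrite vel_linear !vel_mkstate scalerDr !scalerA mulrC.
Qed.

Lemma state_decomp u :
  u = \sum_j rho u j *: scalar_state j + \sum_s vector_state s (vel u s).
Proof.
apply: state_eq => [k|p].
  rewrite rhoD !rho_sum [X in _ + X]big1 ?addr0; last by move=> s _; rewrite rho_mkstate.
  rewrite (bigD1 k)//= big1 ?addr0 => [|j jk]; rewrite rhoZ rho_mkstate.
    by rewrite eqxx mulr1.
  by rewrite eq_sym (negbTE jk) mulr0.
rewrite velD !vel_sum big1 ?add0r => [|j _]; last by rewrite velZ vel_mkstate scaler0.
rewrite (bigD1 p)//= big1 ?addr0 => [|j jp]; rewrite vel_mkstate.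
  by rewrite eqxx scale1r.
by rewrite eq_sym (negbTE jp) scale0r.
Qed.

End States.

(** * Structure of the matrices and of the source *)
Section Structure.
Variables (R : realType) (l m : nat).
Let N := dimu l m.
Variables (A : 'I_3 -> 'M[R]_N) (q : 'I_N -> 'M[R]_N).
Hypothesis inv : rotational_invariant A q.
Implicit Types (u w : 'cV[R]_N) (xi x : 'cV[R]_3).

Lemma symbol_linear u : linear (fun xi => symbol A xi *m u).
Proof.
move=> a xi eta; rewrite /symbol !mulmx_suml scaler_sumr -big_split /=.
by apply: eq_bigr => i _; rewrite !mxE scalerDl mulmxDl -scalerA -scalemxAl.
Qed.

Lemma rho_symbol_scalar xi j k : rho (symbol A xi *m scalar_state R m j) k = 0.
Proof.
apply: (@isotropic1 _ (fun xi => rho (symbol A xi *m scalar_state R m j) k)).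
  by move=> a x y; rewrite symbol_linear rho_linear.
move=> O x rO; rewrite -(rotmx_scalar m O j) (symbol_equivariant _ _ inv rO).
by rewrite rho_rotmx rotmx_scalar.
Qed.

(** The constants are the values of the blocks of A(xi) at basis vectors. *)
Definition bcoef k s := rho (symbol A (evec 0) *m vector_state l s (evec 0)) k.
Definition ccoef p j := vel (symbol A (evec 0) *m scalar_state R m j) p 0 0.
(** The sign is that of E_i x = x cross e_i = - (e_i cross x). *)
Definition dcoef p s := - vel (symbol A (evec 0) *m vector_state l s (evec 1)) p 2 0.

Lemma rho_symbol_vector xi s x k :
  rho (symbol A xi *m vector_state l s x) k = bcoef k s * (xi^T *m x) 0 0.
Proof.
apply: (@isotropic2 _ (fun xi x => rho (symbol A xi *m vector_state l s x) k)).
- by move=> y a u v; rewrite symbol_linear rho_linear.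
- by move=> y a u v; rewrite vector_state_linear mulmxDr -scalemxAr rho_linear.
- by move=> O u v rO; rewrite -rotmx_vector (symbol_equivariant _ _ inv rO) rho_rotmx.
Qed.

Lemma vel_symbol_scalar xi j p :
  vel (symbol A xi *m scalar_state R m j) p = ccoef p j *: xi.
Proof.
apply: (@isotropic_linear _ (fun xi => vel (symbol A xi *m scalar_state R m j) p)).
  by move=> a x y; rewrite symbol_linear vel_linear.
by move=> O x rO; rewrite -vel_rotmx -(symbol_equivariant _ _ inv rO) rotmx_scalar.
Qed.

Lemma vel_symbol_vector xi s x p :
  vel (symbol A xi *m vector_state l s x) p = - dcoef p s *: crossprod xi x.
Proof.
rewrite /dcoef opprK.
apply: (@isotropic_bilinear _ (fun xi x => vel (symbol A xi *m vector_state l s x) p)).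
- by move=> y a u v; rewrite symbol_linear vel_linear.
- by move=> y a u v; rewrite vector_state_linear mulmxDr -scalemxAr vel_linear.
- by move=> O u v rO; rewrite -rotmx_vector (symbol_equivariant _ _ inv rO) vel_rotmx.
Qed.

Lemma symbol_evec i : symbol A (evec i) = A i.
Proof.
rewrite /symbol (bigD1 i)//= big1 ?addr0 => [|j ji]; rewrite !mxE.
  by rewrite !eqxx scale1r.
by rewrite (negbTE ji) scale0r.
Qed.

Lemma Emx_mul i x : Emx i *m x = - crossprod (evec i) x.
Proof.
apply/colP; move: i; apply: ord3P; apply: ord3P; rewrite !mxE sum3E !mxE /=; ring.
Qed.

Lemma mulmx_ext n (M M' : 'M[R]_n) : (forall u : 'cV_n, M *m u = M' *m u) -> M = M'.
Proof.
move=> e; apply/matrixP => i j.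
by have /colP/(_ i) := e (delta_mx j 0); rewrite -!colE !mxE.
Qed.

Lemma symbol_structure i :
  A i = block_mx 0 (Bmx bcoef i) (Cmx ccoef i) (Dmx dcoef i).
Proof.
apply: mulmx_ext => u; rewrite -symbol_evec; apply: state_eq => [k|p].
  rewrite [u in LHS]state_decomp mulmxDr !mulmx_sumr rhoD !rho_sum.
  rewrite big1 ?add0r; last first.
    by move=> j _; rewrite -scalemxAr rhoZ rho_symbol_scalar mulr0.
  rewrite -[u in RHS]vsubmxK mul_block_col mul0mx add0r /rho col_mxKu.
  rewrite -[dsubmx u]submxcolK mul_mxrow_mxcol summxE.
  apply: eq_bigr => s _; rewrite -/(rho _ k) rho_symbol_vector evec_pair -/(vel u s).
  move: (vel u s) => x; rewrite mxE; under eq_bigr do rewrite !mxE.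
  rewrite (bigD1 i)//= big1 ?addr0 => [|j ji]; first by rewrite !eqxx mulr1.
  by rewrite (negbTE ji) mulr0 mul0r.
rewrite [u in LHS]state_decomp mulmxDr !mulmx_sumr velD !vel_sum.
rewrite -[u in RHS]vsubmxK mul_block_col /vel col_mxKd submxcolD; congr (_ + _).
  rewrite -submxcol_mul mxcolK; apply/colP => a; rewrite summxE [RHS]mxE.
  apply: eq_bigr => j _; rewrite -scalemxAr -/(vel _ p) velZ vel_symbol_scalar.
  by rewrite /rho !mxE; ring.
rewrite -submxcol_mul /Dmx mxblockEv mxcolK.
rewrite -[dsubmx u in RHS]submxcolK mul_mxrow_mxcol; apply: eq_bigr => s _.
by rewrite -/(vel _ p) vel_symbol_vector -scalemxAl Emx_mul scalerN scaleNr.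
Qed.

Lemma bilinDl u u' w : bilin q (u + u') w = bilin q u w + bilin q u' w.
Proof.
apply/colP => i; rewrite [RHS]mxE !bilinE -big_split; apply: eq_bigr => j _.
by rewrite -big_split; apply: eq_bigr => k _; rewrite /= !mxE; ring.
Qed.

Lemma bilinDr u w w' : bilin q u (w + w') = bilin q u w + bilin q u w'.
Proof.
apply/colP => i; rewrite [RHS]mxE !bilinE -big_split; apply: eq_bigr => j _.
by rewrite -big_split; apply: eq_bigr => k _; rewrite /= !mxE; ring.
Qed.

(** Invariance of Q is a statement on the quadratic form only; it passes to its
    symmetrized bilinear form, not to the given coefficients q. *)
Definition polar u w := bilin q u w + bilin q w u.

Lemma polar_sym u w : polar u w = polar w u.
Proof. by rewrite /polar addrC. Qed.

Lemma polar_linear w : linear (polar^~ w).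
Proof.
move=> a u v; rewrite /polar bilinDl bilinDr.
rewrite -{1}(scale1r w) -[in X in _ + (X + _)](scale1r w) !bilinZ.
by rewrite mulr1 mul1r addrACA -scalerDr.
Qed.

Lemma polar_linearr w : linear (polar w).
Proof. by move=> a u v; rewrite polar_sym polar_linear ![polar _ w]polar_sym. Qed.

Lemma polar_equivariant O u w : is_rotation O ->
  polar (rotmx l m O *m u) (rotmx l m O *m w) = rotmx l m O *m polar u w.
Proof.
move=> rO; have pE v v' : polar v v' =
    bilin q (v + v') (v + v') - bilin q v v - bilin q v' v'.
  rewrite /polar bilinDl !bilinDr (addrC (bilin q v v)) !addrA.
  by rewrite [RHS]addrAC addrK [RHS]addrAC addrK.
by rewrite !pE -mulmxDr !(source_equivariant _ inv rO) !mulmxBr.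
Qed.

Lemma bilin_polar u : bilin q u u = 2^-1 *: polar u u.
Proof.
rewrite /polar -mulr2n -(scaler_nat 2 (bilin q u u)) scalerA.
by rewrite mulVf ?pnatr_eq0// scale1r.
Qed.

Lemma bilin_expand u w :
  bilin q (u + w) (u + w) = bilin q u u + polar u w + bilin q w w.
Proof. by rewrite bilinDl !bilinDr /polar !addrA. Qed.

Lemma polar_suml (I : finType) (f : I -> 'cV[R]_N) w :
  polar (\sum_i f i) w = \sum_i polar (f i) w.
Proof.
have D u u' : polar (u + u') w = polar u w + polar u' w.
  by rewrite -[u]scale1r polar_linear !scale1r.
apply: (big_morph (polar^~ w) D).
by have := polar_linear w (-1) 0 0; rewrite scaler0 addr0 scaleN1r addNr.
Qed.

Lemma polar_sumr (I : finType) (f : I -> 'cV[R]_N) u :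
  polar u (\sum_i f i) = \sum_i polar u (f i).
Proof. by rewrite polar_sym polar_suml; apply: eq_bigr => i _; rewrite polar_sym. Qed.

Lemma polarZl (a : R) u w : polar (a *: u) w = a *: polar u w.
Proof. by rewrite /polar -[w]scale1r !bilinZ !scale1r mulr1 mul1r scalerDr. Qed.

Lemma polarZr (a : R) u w : polar u (a *: w) = a *: polar u w.
Proof. by rewrite polar_sym polarZl polar_sym. Qed.

Lemma rho_polar_scalar_vector j s x k :
  rho (polar (scalar_state R m j) (vector_state l s x)) k = 0.
Proof.
apply: (@isotropic1 _ (fun x => rho (polar (scalar_state R m j) (vector_state l s x)) k)).
  by move=> a y z; rewrite vector_state_linear polar_linearr rho_linear.
move=> O y rO; rewrite -rotmx_vector -(rotmx_scalar m O j) polar_equivariant//.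
by rewrite rho_rotmx rotmx_scalar.
Qed.

Definition Omegacoef k s r :=
  2^-1 * rho (polar (vector_state l s (evec 0)) (vector_state l r (evec 0))) k.
Definition Upsiloncoef p j r :=
  vel (polar (scalar_state R m j) (vector_state l r (evec 0))) p 0 0.
Definition Omegabarcoef p s r :=
  2^-1 * vel (polar (vector_state l s (evec 0)) (vector_state l r (evec 1))) p 2 0.

Lemma rho_polar_vector s r x y k :
  2^-1 * rho (polar (vector_state l s x) (vector_state l r y)) k =
  Omegacoef k s r * (x^T *m y) 0 0.
Proof.
rewrite /Omegacoef -mulrA; congr (_ * _).
apply: (@isotropic2 _ (fun x y =>
  rho (polar (vector_state l s x) (vector_state l r y)) k)).
- by move=> z a u v; rewrite vector_state_linear polar_linear rho_linear.
- by move=> z a u v; rewrite vector_state_linear polar_linearr rho_linear.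
- by move=> O u v rO; rewrite -!rotmx_vector polar_equivariant// rho_rotmx.
Qed.

Lemma vel_polar_scalar_vector j r x p :
  vel (polar (scalar_state R m j) (vector_state l r x)) p = Upsiloncoef p j r *: x.
Proof.
apply: (@isotropic_linear _ (fun x =>
  vel (polar (scalar_state R m j) (vector_state l r x)) p)).
  by move=> a y z; rewrite vector_state_linear polar_linearr vel_linear.
move=> O y rO; rewrite -rotmx_vector -{1}(rotmx_scalar m O j).
by rewrite polar_equivariant// vel_rotmx.
Qed.

Lemma vel_polar_vector s r x y p :
  2^-1 *: vel (polar (vector_state l s x) (vector_state l r y)) p =
  Omegabarcoef p s r *: crossprod x y.
Proof.
rewrite /Omegabarcoef -scalerA; congr (_ *: _).
apply: (@isotropic_bilinear _ (fun x y =>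
  vel (polar (vector_state l s x) (vector_state l r y)) p)).
- by move=> z a u v; rewrite vector_state_linear polar_linear vel_linear.
- by move=> z a u v; rewrite vector_state_linear polar_linearr vel_linear.
- by move=> O u v rO; rewrite -!rotmx_vector polar_equivariant// vel_rotmx.
Qed.

Lemma vel_polar_scalar i j p :
  vel (polar (scalar_state R m i) (scalar_state R m j)) p = 0.
Proof.
apply: isotropic_vector => O rO; rewrite -vel_rotmx -polar_equivariant//.
by rewrite !rotmx_scalar.
Qed.

Definition Gammacoef k i j :=
  2^-1 * rho (polar (scalar_state R m i) (scalar_state R m j)) k.

(** The mixed terms occur twice in the polarization, whence a factor 1/2 on the
    other two sums only. *)
Lemma source_decomp u : bilin q u u =
  \sum_i \sum_j (rho u i * rho u j) *:
    (2^-1 *: polar (scalar_state R m i) (scalar_state R m j)) +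
  \sum_j \sum_r rho u j *: polar (scalar_state R m j) (vector_state l r (vel u r)) +
  \sum_s \sum_r 2^-1 *: polar (vector_state l s (vel u s)) (vector_state l r (vel u r)).
Proof.
rewrite {1 2}(state_decomp u) bilin_expand !bilin_polar.
rewrite !polar_suml !scaler_sumr; congr (_ + _ + _); apply: eq_bigr => i _.
- rewrite polar_sumr scaler_sumr; apply: eq_bigr => j _.
  by rewrite polarZl polarZr !scalerA; congr (_ *: _); ring.
- by rewrite polar_sumr; apply: eq_bigr => j _; rewrite polarZl.
- by rewrite polar_sumr scaler_sumr.
Qed.

Lemma rho_source u k : rho (bilin q u u) k =
  \sum_i \sum_j Gammacoef k i j * (rho u i * rho u j) +
  \sum_s \sum_r Omegacoef k s r * ((vel u s)^T *m vel u r) 0 0.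
Proof.
rewrite source_decomp !rhoD !rho_sum [X in _ + X + _]big1 ?addr0; last first.
  move=> j _; rewrite rho_sum big1// => r _.
  by rewrite rhoZ rho_polar_scalar_vector mulr0.
congr (_ + _); apply: eq_bigr => i _; rewrite rho_sum; apply: eq_bigr => j _.
  by rewrite !rhoZ mulrC.
by rewrite rhoZ rho_polar_vector.
Qed.

Lemma vel_source u p : vel (bilin q u u) p =
  \sum_j \sum_r (Upsiloncoef p j r * rho u j) *: vel u r +
  \sum_s \sum_r Omegabarcoef p s r *: crossprod (vel u s) (vel u r).
Proof.
rewrite source_decomp !velD !vel_sum [X in X + _ + _]big1 ?add0r; last first.
  move=> i _; rewrite vel_sum big1// => j _.
  by rewrite !velZ vel_polar_scalar !scaler0.
congr (_ + _); apply: eq_bigr => i _; rewrite vel_sum; apply: eq_bigr => j _.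
  by rewrite velZ vel_polar_scalar_vector scalerA mulrC.
by rewrite velZ vel_polar_vector.
Qed.

End Structure.

Theorem lemma1p1 (R : realType) (l m : nat)
    (A : 'I_3 -> 'M[R]_(dimu l m)) (q : 'I_(dimu l m) -> 'M[R]_(dimu l m)) :
  hyperbolic A ->
  rotational_invariant A q ->
  (exists (b : 'I_l -> 'I_m -> R) (c : 'I_m -> 'I_l -> R)
          (d : 'I_m -> 'I_m -> R),
     forall i : 'I_3, A i = block_mx 0 (Bmx b i) (Cmx c i) (Dmx d i))
  /\
  (exists (Gamma : 'I_l -> 'I_l -> 'I_l -> R)
          (Omega : 'I_l -> 'I_m -> 'I_m -> R)
          (Upsilonbar : 'I_m -> 'I_l -> 'I_m -> R)
          (Omegabar : 'I_m -> 'I_m -> 'I_m -> R),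
     forall u : 'cV[R]_(dimu l m),
       (forall k : 'I_l,
          rho (bilin q u u) k =
            \sum_(i < l) \sum_(j < l) Gamma k i j * (rho u i * rho u j)
            + \sum_(s < m) \sum_(r < m)
                Omega k s r * ((vel u s)^T *m vel u r) 0 0)
       /\
       (forall p : 'I_m,
          vel (bilin q u u) p =
            \sum_(j < l) \sum_(r < m)
              (Upsilonbar p j r * rho u j) *: vel u r
            + \sum_(s < m) \sum_(r < m)
                Omegabar p s r *: crossprod (vel u s) (vel u r))).
Proof.
move=> _ inv; split.
  exists (bcoef A), (ccoef A), (dcoef A) => i; exact: (symbol_structure inv).
exists (Gammacoef q), (Omegacoef q), (Upsiloncoef q), (Omegabarcoef q) => u.
by split=> [k|p]; [exact: (rho_source inv)|exact: (vel_source inv)].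
Qed.
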